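(* Let $A\ge 2$ and suppose $\pi^{\mathrm{expl}}_t(a\mid s)>0$ for all $t,s,a$. Suppose the MDP is 1-QVI-solvable and all rewards are nonnegative. Let $$M_1=\max\Big\{\frac{Q^1_t(s,a)\,V^*_t(s)}{\Delta^1_t(s)^2}:\ t\in[T],\ s\in\mathcal S^{\mathrm{opt}}_t,\ \Delta^1_t(s)<\infty,\ a\in\mathcal A\Big\}$$ (with $M_1=1$ if the set is empty), $\bar H_1=1+\log_AM_1+\log_A\big(6\log(2TA)\big)$ and $\rho=\max_{t,s,a}\frac{1}{A\,\pi^{\mathrm{expl}}_t(a\mid s)}$. Then PG-GORP with $m=\lceil 2A^{\bar H_1}\rho\rceil$ returns an optimal policy with probability at least $1/2$, using $T^2m$ timesteps; hence its sample complexity is at most $T^2\lceil 2A^{\bar H_1}\rho\rceil$.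
   Context: Deterministic finite-horizon MDP $\mathcal M=(\mathcal S,\mathcal A,T,s_1,f,R)$: finite states, actions with $A=|\mathcal A|$, start state $s_1$, transitions $s_{t+1}=f(s_t,a_t)$, rewards $R(s_t,a_t)$, steps $t\in[T]$, no discounting. Policies $\pi=(\pi_t)$, $\pi_t:\mathcal S\to\Delta(\mathcal A)$; $Q^\pi_t(s,a)$ is the expected return-to-go $\sum_{t'=t}^TR(s_{t'},a_{t'})$ from $s_t=s,a_t=a$ following $\pi$; $\pi$ is optimal if it maximizes $J(\pi)=\mathbb E_\pi[\sum_{t=1}^TR(s_t,a_t)]$; $V^*_t(s)$ is the maximal expected return-to-go from $s_t=s$; $\mathcal S^{\mathrm{opt}}_t$ is the set of states visited at step $t$ by some optimal policy. $\pi^{\mathrm{expl}}$ is a fixed exploration policy. $Q^1=Q^{\pi^{\mathrm{expl}}}$; the MDP is 1-QVI-solvable if every deterministic policy $\pi$ with $\pi_t(s)\in\arg\max_aQ^1_t(s,a)$ for all $s,t$ is optimal. Gap: $\Delta^1_t(s)=\max_aQ^1_t(s,a)-\max_{a'\notin\arg\max_aQ^1_t(s,a)}Q^1_t(s,a')$ ($=+\infty$ if all actions maximize). PG-GORP$(m)$: initialize $\pi\gets\pi^{\mathrm{expl}}$; for $i=1,\dots,T$: sample $m$ episodes following the current $\pi$ (reaching the state $s_i$ at step $i$, which is the same in all episodes since $\pi_1,\dots,\pi_{i-1}$ are deterministic by then); for each $a\in\mathcal A$ set $\hat\nabla_i(a\mid s_i)=\frac1m\sum_{j=1}^m\frac{\mathbf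 1\{a^j_i=a\}}{\pi_i(a\mid s_i)}\sum_{t=i}^TR(s^j_t,a^j_t)$, where superscript $j$ indexes episodes; then set $\pi_i$ at $s_i$ to deterministically choose an element of $\arg\max_a\hat\nabla_i(a\mid s_i)$. Return $\pi$. Each episode counts $T$ timesteps. The sample complexity of an algorithm is the minimum number $n$ of timesteps such that its output after $n$ timesteps is optimal with probability at least $1/2$. *)

(* Defs.v *)
From HB Require Import structures.
From mathcomp Require Import all_boot all_order all_algebra.
From mathcomp Require Import boolp classical_sets reals exp.

Set Implicit Arguments.
Unset Strict Implicit.
Unset Printing Implicit Defensive.

Import Order.TTheory GRing.Theory Num.Theory.
Local Open Scope ring_scope.

(* Deterministic finite-horizon MDP with state space S, action space Act.
   Steps are 0-indexed: t = 0, ..., T-1 (paper's t = 1..T). *)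
Record mdp (R : realType) (S Act : finType) := MDP {
  horizon : nat;
  start   : S;
  trans   : S -> Act -> S;
  rew     : S -> Act -> R
}.

Definition smax (R : realType) (d : R) (l : seq R) : R :=
  if l is x :: xs then foldr Num.max x xs else d.

(* (stochastic) policies: pi t s a = pi_t(a | s); only t < T matters *)
Definition policy (R : realType) (S Act : finType) := nat -> S -> Act -> R.

Section MDPDefs.
Variables (R : realType) (S Act : finType) (M : mdp R S Act).
Local Notation T := (horizon M).
Local Notation f := (trans M).
Local Notation r := (rew M).

(* an episode is the sequence of actions a_0..a_{T-1}; states are determined *)
Definition traj := {ffun 'I_T -> Act}.

Fixpoint stateAt (w : traj) (k : nat) : S :=
  match k with
  | 0 => start M
  | k'.+1 => let s := stateAt w k' in
             if (insub k' : option 'I_T) is Some t then f s (w t) else s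
  end.

Definition trajProb (pi : policy R S Act) (w : traj) : R :=
  \prod_(t < T) pi t (stateAt w t) (w t).

Definition ret (w : traj) : R := \sum_(t < T) r (stateAt w t) (w t).

Definition J (pi : policy R S Act) : R := \sum_(w : traj) trajProb pi w * ret w.

Definition valid_policy (pi : policy R S Act) : Prop :=
  forall t, (t < T)%N -> forall s,
    (forall a, 0 <= pi t s a) /\ \sum_(a : Act) pi t s a = 1.

Definition optimal (pi : policy R S Act) : Prop :=
  valid_policy pi /\ forall pi', valid_policy pi' -> J pi' <= J pi.

Definition Sopt (t : nat) (s : S) : Prop :=
  exists pi, optimal pi /\ exists w : traj, 0 < trajProb pi w /\ stateAt w t = s.

Fixpoint Vtogo (pi : policy R S Act) (n t : nat) (s : S) : R :=
  match n with
  | 0 => 0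
  | n'.+1 => \sum_(a : Act) pi t s a * (r s a + Vtogo pi n' t.+1 (f s a))
  end.

Definition Qfun (pi : policy R S Act) (t : nat) (s : S) (a : Act) : R :=
  r s a + Vtogo pi (T - t.+1) t.+1 (f s a).

Fixpoint Vst (n : nat) (s : S) : R :=
  match n with
  | 0 => 0
  | n'.+1 => smax 0 [seq r s a + Vst n' (f s a) | a <- enum Act]
  end.

Definition Vstar (t : nat) (s : S) : R := Vst (T - t) s.

Definition Qmax (pi : policy R S Act) (t : nat) (s : S) : R :=
  smax 0 [seq Qfun pi t s a | a <- enum Act].

(* gap Delta_t(s) of Q^pi; None encodes +infinity (all actions maximize) *)
Definition gap (pi : policy R S Act) (t : nat) (s : S) : option R :=
  let q := Qmax pi t s in
  let rest := [seq Qfun pi t s a | a <- enum Act & Qfun pi t s a != q] in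
  if rest is [::] then None else Some (q - smax 0 rest).

Definition det_policy (d : nat -> S -> Act) : policy R S Act :=
  fun t s a => (a == d t s)%:R.

(* 1-QVI-solvable w.r.t. the exploration policy piE (Q^1 = Q^piE) *)
Definition QVI1_solvable (piE : policy R S Act) : Prop :=
  forall d : nat -> S -> Act,
    (forall t, (t < T)%N -> forall s a, Qfun piE t s a <= Qfun piE t s (d t s)) ->
    optimal (det_policy d).

Definition Anum : R := #|Act|%:R.

Definition logA (x : R) : R := ln x / ln Anum.

Definition M1 (piE : policy R S Act) : R :=
  smax 1 (pmap (fun x : 'I_T * S * Act =>
     let: (t, s, a) := x in
     if `[< Sopt t s >] then
       (if gap piE t s is Some d then Some (Qfun piE t s a * Vstar t s / d ^+ 2)
        else None)
     else None) (enum {: 'I_T * S * Act})).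

Definition Hbar1 (piE : policy R S Act) : R :=
  1 + logA (M1 piE) + logA (6 * ln (2 * T%:R * Anum)).

Definition rho (piE : policy R S Act) : R :=
  smax 0 [seq (let: (t, s, a) := x in (Anum * piE (val t) s a)^-1)
          | x <- enum {: 'I_T * S * Act}].

Definition m_param (piE : policy R S Act) : nat :=
  `|Num.ceil (2 * Anum `^ (Hbar1 piE) * rho piE)|%N.

Section PGGORP.
Variables (piE : policy R S Act) (choose : nat -> S -> (Act -> R) -> Act) (m : nat).

(* pre = deterministic choices a_0 .. a_{i-1} made so far at the states s_0..s_{i-1};
   current policy: deterministic at (t, s_t) for t < i, piE elsewhere *)
Definition curPol (pre : seq Act) : policy R S Act :=
  fun t s a =>
    if (t < size pre)%N && (s == foldl f (start M) (take t pre))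
    then (a == nth a pre t)%:R
    else piE t s a.

Definition est (pre : seq Act) (W : {ffun 'I_m -> traj}) (a : Act) : R :=
  let i := size pre in
  let si := foldl f (start M) pre in
  m%:R^-1 * \sum_(j < m)
     ([exists t : 'I_T, (val t == i) && (W j t == a)]%:R / curPol pre i si a
      * \sum_(t : 'I_T | (i <= val t)%N) r (stateAt (W j) t) (W j t)).

(* probability that the algorithm, run from stage size pre with n stages left,
   ends with an optimal policy *)
Fixpoint succ (n : nat) (pre : seq Act) : R :=
  match n with
  | 0 => (`[< optimal (curPol pre) >] : bool)%:R
  | n'.+1 =>
      \sum_(W : {ffun 'I_m -> traj})
        (\prod_(j < m) trajProb (curPol pre) (W j)) *
        succ n' (rcons pre (choose (size pre) (foldl f (start M) pre) (est pre W)))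
  end.

(* Pr[ PG-GORP(m) returns an optimal policy ] ; it uses T * m episodes = T^2 m timesteps *)
Definition success_prob : R := succ T [::].

End PGGORP.
End MDPDefs.

(* Main.v *)
Require Import Defs.
From HB Require Import structures.
From mathcomp Require Import all_boot all_order all_algebra.
From mathcomp Require Import ring lra zify.
From mathcomp Require Import boolp classical_sets reals sequences exp.
Import Order.TTheory GRing.Theory Num.Theory.
Local Open Scope ring_scope.

(** At stage i the current policy plays the prefix fixed so far and then explores,
    so the importance-weighted return of an episode is an unbiased estimate of
    Q^1_i(s_i, a), with values in [0, b] for b = V*_i(s_i) rho A. Bounding the
    exponential by its chord on [0, b] gives a Bernstein-type (variance-aware)
    Chernoff bound; at exponential rate u / b with u = Delta / (2 max Q^1), the
    choice of m makes each action deviate by Delta / 2 towards a wrong decision with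
    probability at most 1 / (2 T A). Hence every stage picks a maximizer of Q^1
    except with probability 1 / (2 T). A prefix of such picks extends to a
    deterministic Q^1-greedy policy, which 1-QVI-solvability makes optimal; so its
    states belong to S^opt (where M_1 controls the gap) and a full prefix is an
    optimal policy. *)

Set Implicit Arguments.
Unset Strict Implicit.
Unset Printing Implicit Defensive.

(** * Maxima of finite lists *)

Section Maximum.
Variable R : realType.

Lemma smax_ge (d x : R) (l : seq R) : x \in l -> x <= smax d l.
Proof.
case: l => // y l; rewrite inE /=.
elim: l x => [|z l IHl] x /=; first by rewrite orbF => /eqP ->.
rewrite inE le_max => /orP[xy|/orP[/eqP ->|xl]]; first by rewrite IHl ?xy ?orbT.
  by rewrite lexx.
by rewrite IHl ?xl ?orbT.
Qed.

Lemma smax_mem (d : R) (l : seq R) : l != [::] -> smax d l \in l.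
Proof.
case: l => // x l _ /=; elim: l => [|z l IHl] /=; first by rewrite mem_head.
rewrite /Num.max; case: ifP => _; last by rewrite !inE eqxx orbT.
by move: IHl; rewrite !inE => /orP[->//|->]; rewrite !orbT.
Qed.

End Maximum.

(** * Expectations over action sequences *)

Section Trajectories.
Variables (R : realType) (S Act : finType) (M : mdp R S Act).
Local Notation T := (horizon M).
Local Notation f := (trans M).
Local Notation r := (rew M).

(** Transitions are deterministic, so an episode is known from its list of actions; lists allow
    induction on the number of remaining steps. *)
Definition actions n (w : {ffun 'I_n -> Act}) : seq Act :=
  [seq w i | i <- enum 'I_n].

Lemma size_actions n (w : {ffun 'I_n -> Act}) : size (actions w) = n.
Proof. by rewrite size_map size_enum_ord. Qed.

Lemma nth_actions n (w : {ffun 'I_n -> Act}) a0 (i : 'I_n) :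
  nth a0 (actions w) i = w i.
Proof. by rewrite (nth_map i) ?size_enum_ord // nth_ord_enum. Qed.

Lemma sum_actions_recl n (G : seq Act -> R) :
  \sum_(w : {ffun 'I_n.+1 -> Act}) G (actions w) =
  \sum_a \sum_(w : {ffun 'I_n -> Act}) G (a :: actions w).
Proof.
pose h (p : Act * {ffun 'I_n -> Act}) : {ffun 'I_n.+1 -> Act} :=
  [ffun i => oapp p.2 p.1 (unlift ord0 i)].
pose g (w : {ffun 'I_n.+1 -> Act}) := (w ord0, [ffun i => w (lift ord0 i)]).
rewrite pair_big /= (reindex h) /=; last first.
  exists g => [[a w] _|w _] /=.
    rewrite /g /h ffunE unlift_none /=; congr pair.
    by apply/ffunP => i; rewrite !ffunE liftK.
  apply/ffunP => i; rewrite /h ffunE /=.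
  by case: unliftP => [j ->|->] //=; rewrite ffunE.
apply: eq_bigr => -[a w] _; congr G; rewrite /actions enum_ordSl /=.
rewrite ffunE unlift_none /=; congr cons; rewrite -map_comp.
by apply: eq_map => i /=; rewrite ffunE liftK.
Qed.

Fixpoint seqProb (pi : policy R S Act) t s (l : seq Act) : R :=
  if l is a :: l' then pi t s a * seqProb pi t.+1 (f s a) l' else 1.

Fixpoint seqRet s (l : seq Act) : R :=
  if l is a :: l' then r s a + seqRet (f s a) l' else 0.

(* Expectation of [F] applied to the next [n] actions, from state [s] at step [t]. *)
Fixpoint Ex (pi : policy R S Act) n t s (F : seq Act -> R) : R :=
  if n is n'.+1 then
    \sum_a pi t s a * Ex pi n' t.+1 (f s a) (fun l => F (a :: l))
  else F [::].

Lemma stateAt_actions (w : traj M) k : (k <= T)%N ->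
  stateAt w k = foldl f (start M) (take k (actions w)).
Proof.
elim: k => [|k IHk] kT; first by rewrite take0.
rewrite /= insubT /= IHk ?(ltnW kT) //.
rewrite (take_nth (w (Ordinal kT))) ?size_actions //.
by rewrite -cats1 foldl_cat /= -[k in nth _ _ k]/(nat_of_ord (Ordinal kT)) nth_actions.
Qed.

Lemma seqProb_nth pi a0 l t0 s :
  \prod_(t < size l) pi (t0 + t)%N (foldl f s (take t l)) (nth a0 l t) =
  seqProb pi t0 s l.
Proof.
elim: l t0 s => [|a l IHl] t0 s /=; first by rewrite big_ord0.
rewrite big_ord_recl /= addn0 -IHl; congr (_ * _).
by apply: eq_bigr => i _; rewrite /= addnS addSn.
Qed.

Lemma seqRet_nth a0 l i s :
  \sum_(t < size l | (i <= t)%N) r (foldl f s (take t l)) (nth a0 l t) =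
  seqRet (foldl f s (take i l)) (drop i l).
Proof.
elim: l i s => [|a l IHl] i s /=; first by rewrite big_ord0.
rewrite big_mkcond big_ord_recl -big_mkcond /=.
case: i => [|i] /=; last by rewrite add0r -IHl; apply: eq_bigl => j.
by rewrite -[X in _ = _ + seqRet _ X]drop0 -[X in seqRet X _]/(foldl f (f s a) [::])
  -(take0 l) -IHl.
Qed.

Lemma trajProb_actions pi (w : traj M) :
  trajProb pi w = seqProb pi 0 (start M) (actions w).
Proof.
(* The default action for [nth] is taken from the episode itself, which requires [T > 0]. *)
rewrite /trajProb; case: (posnP T) => [T0|T_gt0].
  have /size0nil -> : size (actions w) = 0%N by rewrite size_actions.
  by rewrite big1 // => -[i iT]; exfalso; rewrite T0 in iT.
pose a0 := w (Ordinal T_gt0).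
rewrite -(seqProb_nth pi a0) size_actions; apply: eq_bigr => t _.
by rewrite add0n stateAt_actions ?(ltnW (ltn_ord t)) // nth_actions.
Qed.

Lemma ret_actions (w : traj M) i :
  \sum_(t < T | (i <= t)%N) r (stateAt w t) (w t) =
  seqRet (foldl f (start M) (take i (actions w))) (drop i (actions w)).
Proof.
case: (posnP T) => [T0|T_gt0].
  have /size0nil -> : size (actions w) = 0%N by rewrite size_actions.
  by rewrite big1 // => -[j jT]; exfalso; rewrite T0 in jT.
rewrite -(seqRet_nth (w (Ordinal T_gt0))) size_actions; apply: eq_bigr => t _.
by rewrite stateAt_actions ?(ltnW (ltn_ord t)) // nth_actions.
Qed.

Lemma Ex_sum pi n t s (F : seq Act -> R) :
  \sum_(w : {ffun 'I_n -> Act}) seqProb pi t s (actions w) * F (actions w) =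
  Ex pi n t s F.
Proof.
elim: n t s F => [|n IHn] t s F /=.
  rewrite (eq_bigr (fun=> F [::])) => [|w _].
    by rewrite sumr_const card_ffun card_ord expn0.
  by rewrite (size0nil (size_actions w)) mul1r.
rewrite (sum_actions_recl _ (fun l => seqProb pi t s l * F l)).
apply: eq_bigr => a _; rewrite -IHn mulr_sumr.
by apply: eq_bigr => w _; rewrite mulrA.
Qed.

Lemma Ex_traj pi (F : seq Act -> R) :
  \sum_(w : traj M) trajProb pi w * F (actions w) = Ex pi T 0 (start M) F.
Proof. by rewrite -Ex_sum; apply: eq_bigr => w _; rewrite trajProb_actions. Qed.

Lemma J_Ex pi : J M pi = Ex pi T 0 (start M) (seqRet (start M)).
Proof.
rewrite -Ex_traj; apply: eq_bigr => w _; congr (_ * _).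
have := ret_actions w 0; rewrite take0 drop0 /= => <-.
by apply: eq_bigl.
Qed.

Lemma eq_Ex pi n t s F G : (forall l, size l = n -> F l = G l) ->
  Ex pi n t s F = Ex pi n t s G.
Proof.
elim: n t s F G => [|n IHn] t s F G FG /=; first exact: FG.
by apply: eq_bigr => a _; congr (_ * _); apply: IHn => l ln; rewrite FG //= ln.
Qed.

Lemma eq_Ex_policy pi pi' n t s F :
  (forall t' s' a, (t <= t')%N -> pi t' s' a = pi' t' s' a) ->
  Ex pi n t s F = Ex pi' n t s F.
Proof.
elim: n t s F => [|n IHn] t s F E //=.
by apply: eq_bigr => a _; rewrite E // IHn // => t' s' a' /ltnW; exact: E.
Qed.

Lemma ExZ pi n t s c F : Ex pi n t s (fun l => c * F l) = c * Ex pi n t s F.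
Proof.
elim: n t s F => [|n IHn] t s F //=.
by rewrite mulr_sumr; apply: eq_bigr => a _; rewrite IHn mulrCA.
Qed.

Lemma ExD pi n t s F G :
  Ex pi n t s (fun l => F l + G l) = Ex pi n t s F + Ex pi n t s G.
Proof.
elim: n t s F G => [|n IHn] t s F G //=.
by rewrite -big_split; apply: eq_bigr => a _; rewrite IHn mulrDr.
Qed.

Lemma Ex_cst pi n t s c : valid_policy M pi -> (t + n <= T)%N ->
  Ex pi n t s (fun=> c) = c.
Proof.
move=> vpi; elim: n t s => [|n IHn] t s tT //=.
have tlt : (t < T)%N by lia.
rewrite (eq_bigr (fun a => pi t s a * c)) => [|a _]; last by rewrite IHn //; lia.
by rewrite -mulr_suml (vpi _ tlt s).2 mul1r.
Qed.

Lemma Ex_le pi n t s F G : valid_policy M pi -> (t + n <= T)%N ->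
  (forall l, size l = n -> F l <= G l) -> Ex pi n t s F <= Ex pi n t s G.
Proof.
move=> vpi; elim: n t s F G => [|n IHn] t s F G tT FG /=; first exact: FG.
have tlt : (t < T)%N by lia.
apply: ler_sum => a _; rewrite ler_wpM2l ?((vpi _ tlt s).1 a) //.
by apply: IHn => [|l ln]; [lia | rewrite FG //= ln].
Qed.

Lemma Vtogo_Ex pi n t s : valid_policy M pi -> (t + n <= T)%N ->
  Vtogo M pi n t s = Ex pi n t s (seqRet s).
Proof.
move=> vpi; elim: n t s => [|n IHn] t s tT //=.
apply: eq_bigr => a _; rewrite IHn; last by lia.
by rewrite (ExD _ _ _ _ (fun=> r s a)) Ex_cst //; lia.
Qed.

(** Determinism makes the bound pathwise: every action sequence is a feasible plan, so its own
    return, not only a mean return, is below the optimal value. This is how V* enters the range of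
    the estimates. *)
Lemma seqRet_le_Vst s l : seqRet s l <= Vst M (size l) s.
Proof.
elim: l s => [|a l IHl] s //=.
apply: (@le_trans _ _ (r s a + Vst M (size l) (f s a))); first by rewrite lerD2l.
exact/smax_ge/map_f/mem_enum.
Qed.

Lemma Ex_seqRet_le pi n t s : valid_policy M pi -> (t + n <= T)%N ->
  Ex pi n t s (seqRet s) <= Vst M n s.
Proof.
move=> vpi tT; rewrite -[leRHS](Ex_cst (pi := pi) (n := n) (t := t) s) //.
by apply: Ex_le => // l <-; exact: seqRet_le_Vst.
Qed.

Lemma Q_le_Vstar pi t s a : valid_policy M pi -> (t < T)%N ->
  Qfun M pi t s a <= Vstar M t s.
Proof.
move=> vpi tT; rewrite /Vstar -(subnSK tT) /Qfun /=.
apply: le_trans (_ : r s a + Vst M (T - t.+1) (f s a) <= _).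
  by rewrite lerD2l Vtogo_Ex ?Ex_seqRet_le //; lia.
exact/smax_ge/map_f/mem_enum.
Qed.

Hypothesis r_ge0 : forall s a, 0 <= r s a.

Lemma seqRet_ge0 s l : 0 <= seqRet s l.
Proof. by elim: l s => [|a l IHl] s //=; rewrite addr_ge0. Qed.

Lemma Q_ge0 pi t s a : valid_policy M pi -> (t < T)%N -> 0 <= Qfun M pi t s a.
Proof.
move=> vpi tT; rewrite /Qfun addr_ge0 // Vtogo_Ex //; last by lia.
rewrite -[leLHS](@Ex_cst pi (T - t.+1) t.+1 (f s a) 0) //; last by lia.
apply: Ex_le => // [|l _]; [lia | exact: seqRet_ge0].
Qed.

End Trajectories.

(** * Exponential moments and tail bounds *)

Section Concentration.
Variable R : realType.

(* The chord bound by combining the tangent at [l * x] evaluated at [0] and at [l * b]. *)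
Lemma expR_le_chord (b l x : R) : 0 < b -> 0 <= x <= b ->
  expR (l * x) <= 1 + x / b * (expR (l * b) - 1).
Proof.
move=> b0 /andP[x0 xb].
have [z0 zb] : 1 >= expR (l * x) * (1 - l * x) /\
    expR (l * b) >= expR (l * x) * (1 + (l * b - l * x)).
  split; last by rewrite -[l * b in leRHS](subrKC (l * x)) expRD ler_wpM2l
    ?expR_ge0 ?expR_ge1Dx.
  by rewrite -[leRHS](@expR0 R) -(subrr (l * x)) expRD ler_wpM2l ?expR_ge0 ?expR_ge1Dx.
set y := x / b.
have y0 : 0 <= y by rewrite divr_ge0 // ltW.
have y1 : y <= 1 by rewrite ler_pdivrMr // mul1r.
have yb : x = y * b by rewrite mulfVK // gt_eqF.
(* The tangent inequalities are averaged with weights [1 - y] and [y]; since [x = y * b], the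
   tangent terms average to [expR (l * x)] exactly. *)
have h0 : 0 <= (1 - y) * (1 - expR (l * x) * (1 - l * x)).
  by rewrite mulr_ge0 // subr_ge0.
have h1 : 0 <= y * (expR (l * b) - expR (l * x) * (1 + (l * b - l * x))).
  by rewrite mulr_ge0 // subr_ge0.
rewrite -subr_ge0; apply: le_trans (addr_ge0 h0 h1) _.
by rewrite le_eqVlt; apply/orP; left; apply/eqP; rewrite yb; ring.
Qed.

(** Markov's inequality for an exponential whose moment factors over the [m] independent episodes.
    Keeping [l] on both sides of the event lets its sign select the tail: upper for [l > 0], lower
    for [l < 0]. *)
Lemma chernoff (I : finType) (p X : I -> R) (m : nat) (l c k : R) :
  (forall i, 0 <= p i) -> (0 < m)%N -> \sum_i p i * expR (l * X i) <= expR k ->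
  \sum_(W : {ffun 'I_m -> I}) \prod_j p (W j) *
     (l * c <= l * (m%:R^-1 * \sum_j X (W j)))%R%:R <= expR (m%:R * (k - l * c)).
Proof.
move=> p0 m0 mgf; have mR : 0 < m%:R :> R by rewrite ltr0n.
apply: (@le_trans _ _ (\sum_(W : {ffun 'I_m -> I})
    (\prod_j (p (W j) * expR (l * X (W j)))) * expR (- (m%:R * (l * c))))).
  apply: ler_sum => W _; rewrite big_split /= -mulrA ler_wpM2l ?prodr_ge0 //.
  rewrite -expR_sum -expRD -mulr_sumr; case: (leP (l * c)) => [lc|_]; last exact: expR_ge0.
  rewrite -[leLHS](@expR0 R) ler_expR subr_ge0.
  apply: le_trans (ler_wpM2l (ltW mR) lc) _.
  by rewrite mulrCA [m%:R * (_ * _)]mulrA divff ?gt_eqF // mul1r.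
rewrite -mulr_suml -(bigA_distr_bigA (fun _ i => p i * expR (l * X i))) /=.
rewrite prodr_const card_ord mulrBr expRD ler_wpM2r ?expR_ge0 // expRM_natl.
by rewrite lerXn2r ?nnegrE ?expR_ge0 // sumr_ge0 // => i _; rewrite mulr_ge0 ?expR_ge0.
Qed.

Lemma expR_cube (u : R) : expR u = expR (u / 3) ^+ 3.
Proof. by rewrite -expRM_natl mulrC divfK // pnatr_eq0. Qed.

(* [e^u <= (1 - u / 3)^-3] and its mirror image for [e^(-u)] are just sharp enough:
   in the lower tail, the second-order Taylor coefficient [2 / 3] of the cube is
   exactly what the constant [1 / 12] tolerates. *)
Lemma upper_rate (d : R) : 0 < d <= 1 ->
  (expR (d / 2) - 1) * (1 - d) - d / 2 * (1 - d / 2) <= - (d ^+ 2 / 12).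
Proof.
move=> /andP[d0 d1]; set u := d / 2.
have -> : d = 2 * u by rewrite /u; field.
have [u0 u1] : 0 < u /\ u <= 1 / 2 by rewrite /u; lra.
have p0 : 0 < (1 - u / 3) ^+ 3 by rewrite exprn_gt0 //; lra.
have eu : expR u * (1 - u / 3) ^+ 3 <= 1.
  have e1 : expR u * expR (- u) = 1 by rewrite -expRD subrr expR0.
  rewrite -[leRHS]e1 ler_wpM2l ?expR_ge0 // [leRHS]expR_cube.
  rewrite lerXn2r ?nnegrE ?expR_ge0 //; first lra.
  by rewrite mulNr expR_ge1Dx.
move: eu; set e := expR u => eu.
suff : 0 <= (u - 4 / 3 * u ^+ 2 - (e - 1) * (1 - 2 * u)) * (1 - u / 3) ^+ 3.
  by rewrite pmulr_lge0 //; nra.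
have h : 0 <= (1 - e * (1 - u / 3) ^+ 3) * (1 - 2 * u) by rewrite mulr_ge0 //; lra.
(* Once [e] is eliminated by [h], this polynomial is what remains: the terms of order at most 2
   cancel. *)
have g : 0 <= u ^+ 3 * (26 / 27 - 11 / 27 * u + 4 / 81 * u ^+ 2).
  by rewrite mulr_ge0 ?exprn_ge0 //; nra.
apply: le_trans (addr_ge0 h g) _.
by rewrite le_eqVlt; apply/orP; left; apply/eqP; field.
Qed.

Lemma lower_rate (d : R) : 0 < d <= 1 ->
  (expR (- (d / 2)) - 1) + d / 2 * (1 - d / 2) <= - (d ^+ 2 / 12).
Proof.
move=> /andP[d0 d1]; set u := d / 2.
have -> : d = 2 * u by rewrite /u; field.
have [u0 u1] : 0 < u /\ u <= 1 / 2 by rewrite /u; lra.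
have p0 : 0 < (1 + u / 3) ^+ 3 by rewrite exprn_gt0 //; lra.
have eu : expR (- u) * (1 + u / 3) ^+ 3 <= 1.
  have e1 : expR (- u) * expR u = 1 by rewrite -expRD addNr expR0.
  rewrite -[leRHS]e1 ler_wpM2l ?expR_ge0 // [leRHS]expR_cube.
  rewrite lerXn2r ?nnegrE ?expR_ge0 //; first lra.
  by rewrite expR_ge1Dx.
move: eu; set e := expR (- u) => eu.
suff : 0 <= (1 - u + 2 / 3 * u ^+ 2 - e) * (1 + u / 3) ^+ 3 by rewrite pmulr_lge0 //; nra.
(* Here too all terms of order at most 2 cancel against the cubed denominator. *)
have g : 0 <= u ^+ 3 * (10 / 27 + 5 / 27 * u + 2 / 81 * u ^+ 2).
  by rewrite mulr_ge0 ?exprn_ge0 //; nra.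
have h : 0 <= 1 - e * (1 + u / 3) ^+ 3 by rewrite subr_ge0.
apply: le_trans (addr_ge0 h g) _.
by rewrite le_eqVlt; apply/orP; left; apply/eqP; field.
Qed.

(** In the application [p] is the law of an episode, [X] the estimate it yields for one action, [mu]
    the Q-value of that action, [b] the range of [X], [q] the largest Q-value and [D] the gap.
    Boundedness of [X] enters only through [mgf_chord]. *)
Variables (I : finType) (p X : I -> R) (m : nat) (b mu q D L : R).
Hypothesis p_ge0 : forall i, 0 <= p i.
Hypothesis m_gt0 : (0 < m)%N.
Hypothesis b_gt0 : 0 < b.
Hypothesis D_gt0 : 0 < D.
Hypothesis D_le_q : D <= q.
Hypothesis mgf_chord : forall l,
  \sum_i p i * expR (l * X i) <= 1 + mu / b * (expR (l * b) - 1).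
Hypothesis m_large : L * (12 * q * b) <= m%:R * D ^+ 2.

Let mean (W : {ffun 'I_m -> I}) := m%:R^-1 * \sum_j X (W j).

(** Both rates are at most [- d ^+ 2 / 12] at [d = D / q]; the factor [q / b] restores the scale,
    and [m_large] is precisely the requirement on [m] that results. *)
Lemma exponent_le x : x <= - ((D / q) ^+ 2 / 12) ->
  expR (m%:R * (q / b * x)) <= expR (- L).
Proof.
have q0 : 0 < q by apply: lt_le_trans D_le_q.
move=> xle; rewrite ler_expR.
apply: (@le_trans _ _ (m%:R * (q / b * - ((D / q) ^+ 2 / 12)))).
  by rewrite ler_wpM2l // ler_wpM2l // divr_ge0 // ltW.
have -> : m%:R * (q / b * - ((D / q) ^+ 2 / 12)) = - (m%:R * D ^+ 2 / (12 * q * b)).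
  by field; rewrite !gt_eqF.
by rewrite lerN2 ler_pdivlMr // !mulr_gt0.
Qed.

Lemma upper_tail : mu <= q - D ->
  \sum_(W : {ffun 'I_m -> I}) \prod_j p (W j) * (q - D / 2 <= mean W)%R%:R
    <= expR (- L).
Proof.
move=> muq; have q0 : 0 < q by apply: lt_le_trans D_le_q.
pose u := D / q / 2; pose l := u / b.
have l0 : 0 < l by rewrite !divr_gt0.
have lb : l * b = u by rewrite /l divfK // gt_eqF.
(* [1 + y <= expR y] puts the chord bound in the form that [chernoff] takes. *)
have mgf := le_trans (mgf_chord l) (expR_ge1Dx _).
have := chernoff (q - D / 2) p_ge0 m_gt0 mgf.
under eq_bigr do rewrite (ler_pM2l l0).
move/le_trans; apply; rewrite lb.
have -> : mu / b * (expR u - 1) - l * (q - D / 2) =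
    q / b * ((expR u - 1) * (mu / q) - u * (1 - D / q / 2)).
  by rewrite /l /u; field; rewrite !gt_eqF.
apply: exponent_le.
have d01 : 0 < D / q <= 1 by rewrite divr_gt0 // ler_pdivrMr // mul1r.
(* The factor [expR u - 1] is nonnegative, so [mu / q] may be replaced by its upper bound
   [1 - D / q]. *)
apply: le_trans (upper_rate d01); rewrite lerD2r ler_wpM2l //.
  by rewrite subr_ge0 -(@expR0 R) ler_expR ltW // !divr_gt0.
by rewrite ler_pdivrMr // mulrBl mul1r divfK ?gt_eqF.
Qed.

Lemma lower_tail : mu = q ->
  \sum_(W : {ffun 'I_m -> I}) \prod_j p (W j) * (mean W <= q - D / 2)%R%:R
    <= expR (- L).
Proof.
move=> muq; have q0 : 0 < q by apply: lt_le_trans D_le_q.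
(* A negative [l] reverses the event, so the same [chernoff] yields the lower tail. *)
pose u := D / q / 2; pose l := - (u / b).
have l0 : l < 0 by rewrite oppr_lt0 !divr_gt0.
have lb : l * b = - u by rewrite /l mulNr divfK // gt_eqF.
have mgf := le_trans (mgf_chord l) (expR_ge1Dx _).
have := chernoff (q - D / 2) p_ge0 m_gt0 mgf.
under eq_bigr do rewrite (ler_nM2l l0).
move/le_trans; apply; rewrite lb muq.
have -> : q / b * (expR (- u) - 1) - l * (q - D / 2) =
    q / b * ((expR (- u) - 1) + u * (1 - D / q / 2)).
  by rewrite /l /u; field; rewrite !gt_eqF.
apply/exponent_le/lower_rate.
by rewrite divr_gt0 // ler_pdivrMr // mul1r.
Qed.

End Concentration.

(** * Prefixes of maximizing actions and their optimality *)

Section GreedyPrefixes.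
Variables (R : realType) (S Act : finType) (M : mdp R S Act).
Variable piE : policy R S Act.
Local Notation T := (horizon M).
Local Notation f := (trans M).
Local Notation r := (rew M).
Local Notation st pre := (foldl f (start M) pre).
Hypothesis piE_valid : valid_policy M piE.

Lemma valid_curPol pre : valid_policy M (curPol M piE pre).
Proof.
move=> t tT s; split=> [a|]; rewrite /curPol.
  by case: ifP => _; [exact: ler0n | exact: (piE_valid tT s).1].
case C: (_ && _); last exact: (piE_valid tT s).2.
have /andP[tp _] := C.
(* [nth] needs a default action; without any action the prefix would be empty, against
   [t < size pre]. *)
have [a0 _|e] := pickP (@predT Act); last first.
  by move: tp; case: (pre) => // a; have := e a.
rewrite (bigD1 (nth a0 pre t)) //= (set_nth_default a0) // eqxx.
by rewrite big1 ?addr0 // => a /negbTE ane; rewrite (set_nth_default a0) // ane.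
Qed.

(** Agreement is asked only at the states that the prefix visits, which is all that a run from the
    start state meets. *)
Definition follows (a0 : Act) (pi : policy R S Act) (pre : seq Act) :=
  forall t a, (t < size pre)%N ->
    pi t (st (take t pre)) a = (a == nth a0 pre t)%:R.

Lemma curPol_follows a0 pre : follows a0 (curPol M piE pre) pre.
Proof. by move=> t a tp; rewrite /curPol tp eqxx (set_nth_default a0). Qed.

(** Along the prefix the policy is deterministic, so each sum over actions keeps a single term; the
    induction moves actions one by one from [p2] to [p1]. *)
Lemma Ex_follows a0 pi p1 p2 n F : follows a0 pi (p1 ++ p2) ->
  Ex M pi (size p2 + n) (size p1) (st p1) F =
  Ex M pi n (size (p1 ++ p2)) (st (p1 ++ p2)) (fun l => F (p2 ++ l)).
Proof.
elim: p2 p1 F => [|b p2 IHp] p1 F fol /=; first by rewrite cats0.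
have pib a : pi (size p1) (st p1) a = (a == b)%:R.
  have := fol (size p1) a; rewrite size_cat /= take_size_cat // nth_cat ltnn subnn.
  by apply; lia.
rewrite (bigD1 b) //= pib eqxx mul1r big1 ?addr0; last first.
  by move=> a /negbTE ab; rewrite pib ab mul0r.
have := IHp (rcons p1 b) (fun l => F (b :: l)).
by rewrite cat_rcons size_rcons foldl_rcons; apply.
Qed.

Lemma Ex_curPol pre n F :
  Ex M (curPol M piE pre) (size pre + n) 0 (start M) F =
  Ex M piE n (size pre) (st pre) (fun l => F (pre ++ l)).
Proof.
have [a0 _|e] := pickP (@predT Act); last first.
  case: pre F => [|a pre] F; last by have := e a.
  by apply: eq_Ex_policy => t s a; have := e a.
rewrite (@Ex_follows a0 _ [::]); last exact: curPol_follows.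
apply: eq_Ex_policy => t s a pt; rewrite /curPol.
by rewrite ltnNge pt.
Qed.

(** The whole run is forced, so all policies following the same full prefix have the same value. *)
Lemma J_follows a0 pi pre : follows a0 pi pre -> size pre = T ->
  J M pi = seqRet M (start M) pre.
Proof.
move=> fol szT; rewrite J_Ex -szT -[X in Ex _ _ X]addn0.
by rewrite (@Ex_follows a0 _ [::]) //= cats0.
Qed.

Definition greedy t s a := Qfun M piE t s a == Qmax M piE t s.

Lemma Q_le_Qmax t s a : Qfun M piE t s a <= Qmax M piE t s.
Proof. exact/smax_ge/map_f/mem_enum. Qed.

Variable a0 : Act.

Definition greedy_act t s := odflt a0 [pick a | greedy t s a].

Lemma greedy_actP t s : greedy t s (greedy_act t s).
Proof.
rewrite /greedy_act; case: pickP => //= ng.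
have : Qmax M piE t s \in [seq Qfun M piE t s a | a <- enum Act].
  apply: smax_mem; rewrite -size_eq0 size_map -cardE -lt0n.
  by apply/card_gt0P; exists a0.
by case/mapP => a _ /esym/eqP ga; have := ng a; rewrite /greedy ga.
Qed.

Definition greedy_prefix pre :=
  forall k, (k < size pre)%N -> greedy k (st (take k pre)) (nth a0 pre k).

Lemma greedy_prefix_rcons pre a : greedy_prefix pre ->
  greedy (size pre) (st pre) a -> greedy_prefix (rcons pre a).
Proof.
move=> gp ga k; rewrite size_rcons ltnS leq_eqVlt => /orP[/eqP ->|kp].
  by rewrite -cats1 take_size_cat // nth_cat ltnn subnn.
rewrite nth_rcons kp -cats1 takel_cat; last exact: ltnW.
exact: gp.
Qed.

Lemma greedy_prefix_complete n pre : greedy_prefix pre ->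
  exists2 l, size l = n & greedy_prefix (pre ++ l).
Proof.
elim: n pre => [|n IHn] pre gp; first by exists [::]; rewrite ?cats0.
have [l ln gl] := IHn _ (greedy_prefix_rcons gp (greedy_actP (size pre) (st pre))).
by exists (greedy_act (size pre) (st pre) :: l); rewrite /= ?ln // -cat_rcons.
Qed.

(** Unlike [curPol], it maximizes Q^1 off the prefix instead of exploring, so it qualifies at all
    states, as 1-QVI-solvability demands. *)
Definition extend_greedy pre t s :=
  if (t < size pre)%N && (s == st (take t pre)) then nth a0 pre t
  else greedy_act t s.

Lemma extend_greedy_follows pre :
  follows a0 (det_policy R (extend_greedy pre)) pre.
Proof. by move=> t a tp; rewrite /det_policy /extend_greedy tp eqxx. Qed.

Hypothesis solvable : QVI1_solvable M piE.

Lemma extend_greedy_optimal pre : greedy_prefix pre ->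
  optimal M (det_policy R (extend_greedy pre)).
Proof.
move=> gp; apply: solvable => t _ s a.
suff /eqP -> : greedy t s (extend_greedy pre t s) by exact: Q_le_Qmax.
rewrite /extend_greedy; case: ifP => [/andP[tp /eqP ->]|_]; first exact: gp.
exact: greedy_actP.
Qed.

(** [curPol] may still explore off its path, so solvability is applied to [extend_greedy], which
    follows the same full prefix and hence has the same value. *)
Lemma greedy_prefix_optimal pre : greedy_prefix pre -> size pre = T ->
  optimal M (curPol M piE pre).
Proof.
move=> gp szT; split=> [|pi' vpi']; first exact: valid_curPol.
rewrite (J_follows (@curPol_follows a0 pre) szT).
rewrite -(J_follows (@extend_greedy_follows pre) szT).
exact: (extend_greedy_optimal gp).2.
Qed.

(** The prefix is first completed greedily to the full horizon; the episode playing that completion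
    has probability 1 under the resulting optimal policy. *)
Lemma greedy_prefix_Sopt pre : greedy_prefix pre -> (size pre <= T)%N ->
  Sopt M (size pre) (st pre).
Proof.
move=> gp pT; have [l lT gl] := greedy_prefix_complete (T - size pre) gp.
set pre' := pre ++ l in gl; have szT : size pre' = T by rewrite size_cat lT; lia.
pose w : traj M := [ffun t : 'I_T => nth a0 pre' t].
have wE : actions w = pre'.
  apply: (@eq_from_nth _ a0) => [|k]; rewrite size_actions ?szT // => kT.
  by rewrite -[k]/(nat_of_ord (Ordinal kT)) nth_actions ffunE.
exists (det_policy R (extend_greedy pre')); split; first exact: extend_greedy_optimal.
exists w; split; last by rewrite stateAt_actions // wE take_size_cat.
rewrite /trajProb big1 // => t _; rewrite stateAt_actions ?(ltnW (ltn_ord t)) // wE.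
by rewrite extend_greedy_follows ?szT // ffunE eqxx.
Qed.

End GreedyPrefixes.

(** * Sample size, failure of one stage, and success of the whole run *)

Section Algorithm.
Variables (R : realType) (S Act : finType) (M : mdp R S Act).
Variable piE : policy R S Act.
Variable choose : nat -> S -> (Act -> R) -> Act.
Local Notation T := (horizon M).
Local Notation f := (trans M).
Local Notation r := (rew M).
Local Notation st pre := (foldl f (start M) pre).
Local Notation A := (Anum R Act).
Local Notation L := (ln (2 * T%:R * A)).
Local Notation greedy := (greedy M piE).

Hypothesis A2 : (2 <= #|Act|)%N.
Hypothesis piE_valid : valid_policy M piE.
Hypothesis piE_gt0 : forall t, (t < T)%N -> forall s a, 0 < piE t s a.
Hypothesis solvable : QVI1_solvable M piE.
Hypothesis r_ge0 : forall s a, 0 <= r s a.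
Hypothesis choose_max : forall i s (g : Act -> R) a, g a <= g (choose i s g).

Lemma A_gt1 : 1 < A. Proof. by rewrite ltr1n. Qed.

Lemma A_gt0 : 0 < A. Proof. exact: lt_trans ltr01 A_gt1. Qed.

Lemma trajProb_ge0 pi (w : traj M) : valid_policy M pi -> 0 <= trajProb pi w.
Proof. by move=> vpi; apply: prodr_ge0 => t _; apply: (vpi t _ _).1. Qed.

Lemma sum_trajProb m pi : valid_policy M pi ->
  \sum_(W : {ffun 'I_m -> traj M}) \prod_(j < m) trajProb pi (W j) = 1.
Proof.
move=> vpi; rewrite -(bigA_distr_bigA (fun _ w => trajProb pi w)) /=.
rewrite prodr_const (_ : \sum_w _ = 1) ?expr1n //.
have := Ex_traj M pi (fun=> 1); rewrite Ex_cst // => <-.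
by apply: eq_bigr => w _; rewrite mulr1.
Qed.

Lemma powR_logA x : 0 < x -> A `^ logA Act x = x.
Proof.
move=> x0; rewrite /powR gt_eqF ?A_gt0 // /logA divfK ?lnK ?posrE //.
by rewrite gt_eqF // ln_gt0 // A_gt1.
Qed.

Lemma invp_le_rho t s a : (t < T)%N -> (piE t s a)^-1 <= rho M piE * A.
Proof.
move=> tT; rewrite -ler_pdivrMr ?A_gt0 // -invfM mulrC [A * _]mulrC mulrC.
by apply/smax_ge/mapP; exists (Ordinal tT, s, a); rewrite ?mem_enum.
Qed.

Lemma rho_gt0 t (s : S) (a : Act) : (t < T)%N -> 0 < rho M piE.
Proof.
move=> tT; rewrite -(pmulr_lgt0 _ A_gt0).
by apply: lt_le_trans (invp_le_rho s a tT); rewrite invr_gt0 piE_gt0.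
Qed.

Lemma L_gt0 : (0 < T)%N -> 0 < L.
Proof.
move=> T0; rewrite ln_gt0 // -mulrA; have := A_gt1.
by have : 1 <= T%:R :> R; [rewrite ler1n | nra].
Qed.

(** [Hbar1] is built so that A to this power is [6 * A * M1 * L]; the factor 2 in [m_param] then
    gives the 12 that the tail bounds ask for. *)
Lemma m_param_ge (t : nat) (s : S) (a : Act) x : (t < T)%N ->
  0 < x -> x <= M1 M piE ->
  12 * A * x * rho M piE * L <= (m_param M piE)%:R.
Proof.
move=> tT x0 xM; have M0 : 0 < M1 M piE by apply: lt_le_trans xM.
have L0 : 0 < L by apply: L_gt0; lia.
have rho0 := rho_gt0 s a tT.
have Hb : A `^ Hbar1 M piE = A * M1 M piE * (6 * L).
  rewrite /Hbar1 !powRD ?(gt_eqF A_gt0) ?implybT // powRr1 ?ltW ?A_gt0 //.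
  by rewrite !powR_logA // mulr_gt0.
rewrite /m_param natr_absz Hb.
have c0 : 0 <= A * rho M piE * L by rewrite !mulr_ge0 ?ltW ?A_gt0.
apply: le_trans (_ : 2 * (A * M1 M piE * (6 * L)) * rho M piE <= _); last first.
  by apply: le_trans (ceil_ge _) _; rewrite ler_int ler_norm.
have := ler_wpM2l c0 xM; lra.
Qed.

(** The importance-weighted return of one episode. The weight uses [piE] because the current policy
    still explores at step [size pre]. *)
Definition score (pre : seq Act) a (l : seq Act) : R :=
  let i := size pre in
  (ohead (drop i l) == Some a)%:R / piE i (st pre) a
    * seqRet M (st (take i l)) (drop i l).

Lemma est_score m pre (W : {ffun 'I_m -> traj M}) a : (size pre < T)%N ->
  est piE pre W a = m%:R^-1 * \sum_j score pre a (actions (W j)).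
Proof.
move=> iT; congr (_ * _); apply: eq_bigr => j _; rewrite ret_actions /score.
rewrite /curPol ltnn /=; do 2 congr (_ * _); congr (nat_of_bool _)%:R.
pose t := Ordinal iT.
rewrite (drop_nth a) ?size_actions //= -[X in nth _ _ X]/(nat_of_ord t).
rewrite nth_actions; apply/existsP/eqP => [[t' /andP[/eqP t't /eqP <-]]|[<-]].
  by congr (Some (W j _)); apply: val_inj.
by exists t; rewrite !eqxx.
Qed.

Lemma score_cat pre a l : score pre a (pre ++ l) =
  (ohead l == Some a)%:R / piE (size pre) (st pre) a * seqRet M (st pre) l.
Proof. by rewrite /score take_size_cat // drop_size_cat. Qed.

(** The probability of playing [a] cancels the importance weight, which leaves its reward plus the
    expected return of exploring afterwards. *)
Lemma Ex_score pre a : (size pre < T)%N ->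
  Ex M piE (T - size pre) (size pre) (st pre) (fun l => score pre a (pre ++ l)) =
  Qfun M piE (size pre) (st pre) a.
Proof.
move=> iT; set i := size pre; set s := st pre.
have pa0 : piE i s a != 0 by rewrite gt_eqF // piE_gt0.
rewrite -(subnSK iT) /=.
have E a' : Ex M piE (T - i.+1) i.+1 (f s a') (fun l => score pre a (pre ++ a' :: l)) =
    (a' == a)%:R / piE i s a * Qfun M piE i s a'.
  rewrite -[in RHS]/i /Qfun Vtogo_Ex //; last by rewrite subnKC.
  rewrite -[r s a' in RHS](@Ex_cst _ _ _ M piE (T - i.+1) i.+1 (f s a')) ?subnKC //.
  rewrite -ExD -ExZ; apply: eq_Ex => l _; rewrite score_cat /=.
  by rewrite (inj_eq Some_inj).
under eq_bigr do rewrite E.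
rewrite (bigD1 a) //= eqxx mul1r mulVKf // big1 ?addr0 // => a' /negbTE ->.
by rewrite !mul0r mulr0.
Qed.

Lemma score_mgf pre a (l : R) : (size pre < T)%N ->
  let b := Vstar M (size pre) (st pre) * (rho M piE * A) in
  0 < b ->
  \sum_(w : traj M) trajProb (curPol M piE pre) w * expR (l * score pre a (actions w))
  <= 1 + Qfun M piE (size pre) (st pre) a / b * (expR (l * b) - 1).
Proof.
move=> iT b b0; rewrite (Ex_traj _ _ (fun x => expR (l * score pre a x))).
rewrite -{1}(subnKC (ltnW iT)) Ex_curPol.
have iTT : (size pre + (T - size pre) <= T)%N by rewrite subnKC // ltnW.
pose k := (expR (l * b) - 1) / b.
apply: (@le_trans _ _ (Ex M piE (T - size pre) (size pre) (st pre)
   (fun x => 1 + k * score pre a (pre ++ x)))); last first.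
  rewrite ExD Ex_cst // ExZ Ex_score // /k.
  by rewrite lerD2l mulrC -mulrA [b^-1 * _]mulrC mulrA mulrAC.
apply: Ex_le => // x szx.
(* The return lies between 0 and V*, and the weight is at most [rho * A]. *)
have [s0 sb] : 0 <= score pre a (pre ++ x) /\ score pre a (pre ++ x) <= b.
  have p0 := piE_gt0 iT (st pre) a.
  have h1 := seqRet_ge0 r_ge0 (st pre) x.
  have h2 : seqRet M (st pre) x <= Vstar M (size pre) (st pre).
    by rewrite /Vstar -szx seqRet_le_Vst.
  have h3 : 0 <= (piE (size pre) (st pre) a)^-1 by rewrite invr_ge0 ltW.
  have h4 := invp_le_rho (st pre) a iT.
  rewrite score_cat; case: eqP => _; rewrite ?mul0r ?mul1r; last by rewrite lexx ltW.
  by rewrite mulr_ge0 // /b mulrC ler_pM.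
have sE : score pre a (pre ++ x) / b * (expR (l * b) - 1) = k * score pre a (pre ++ x).
  by rewrite /k; ring.
by rewrite -sE expR_le_chord ?s0.
Qed.

Lemma gap_None t s a : gap M piE t s = None -> greedy t s a.
Proof.
rewrite /gap; case E : [seq _ | _ <- _ & _] => [|//] _.
apply/negPn/negP => ng; suff : Qfun M piE t s a \in [::] by [].
by rewrite -E map_f // mem_filter ng mem_enum.
Qed.

(** [D] is at most the maximum because nonnegative rewards make the runner-up value nonnegative;
    this keeps [D / q] in the range of the rate bounds. *)
Lemma gap_Some t s D : (t < T)%N -> gap M piE t s = Some D ->
  [/\ 0 < D, D <= Qmax M piE t s &
      forall a, ~~ greedy t s a -> Qfun M piE t s a <= Qmax M piE t s - D].
Proof.
move=> tT; rewrite /gap; set rest := [seq _ | _ <- _ & _].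
have memr a : ~~ greedy t s a -> Qfun M piE t s a \in rest.
  by move=> ng; rewrite map_f // mem_filter ng mem_enum.
have ubr a : ~~ greedy t s a -> Qfun M piE t s a <= smax 0 rest.
  by move=> /memr; exact: smax_ge.
have rest0 : rest != [::] -> exists2 a, ~~ greedy t s a & smax 0 rest = Qfun M piE t s a.
  by move=> /(smax_mem 0)/mapP[a]; rewrite mem_filter => /andP[ng _] ->; exists a.
move: (smax 0 rest) ubr rest0 => sm ubr rest0.
case: (rest) rest0 => // x l /(_ isT)[a ng E] [<-]; split.
- by rewrite subr_gt0 E lt_neqAle ng Q_le_Qmax.
- by rewrite lerBlDr lerDl E Q_ge0.
- by move=> c /ubr; rewrite subKr.
Qed.

Lemma M1_ge t s a D : (t < T)%N -> Sopt M t s -> gap M piE t s = Some D ->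
  Qfun M piE t s a * Vstar M t s / D ^+ 2 <= M1 M piE.
Proof.
move=> tT so gD; apply: smax_ge; rewrite mem_pmap; apply/mapP.
by exists (Ordinal tT, s, a); rewrite ?mem_enum //= (asboolT so) gD.
Qed.

Variable a0 : Act.
Local Notation m := (m_param M piE).

Lemma stage_failure pre : (size pre < T)%N -> greedy_prefix M piE a0 pre ->
  \sum_(W : {ffun 'I_m -> traj M})
     \prod_j trajProb (curPol M piE pre) (W j) *
     (~~ greedy (size pre) (st pre)
          (choose (size pre) (st pre) (est piE pre W)))%:R
  <= (2 * T%:R)^-1.
Proof.
move=> iT gp; set i := size pre; set s := st pre.
have T0 : 0 < T%:R :> R by rewrite ltr0n; lia.
have pol := valid_curPol piE_valid pre.
(* With an infinite gap every action is a maximizer and the stage cannot fail. *)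
case gD : (gap M piE i s) => [D|]; last first.
  rewrite big1 => [|W _]; last by rewrite gap_None // mulr0.
  by rewrite invr_ge0 mulr_ge0 // ltW.
have [D0 Dq Qng] := gap_Some iT gD.
set q := Qmax M piE i s in Dq Qng.
have q0 : 0 < q by apply: lt_le_trans Dq.
pose g := greedy_act M piE a0 i s.
have gg : greedy i s g by exact: greedy_actP.
have Qg : Qfun M piE i s g = q by apply/eqP.
have V0 : 0 < Vstar M i s.
  by apply: lt_le_trans q0 _; rewrite -Qg Q_le_Vstar.
have rho0 := rho_gt0 s a0 iT.
pose b := Vstar M i s * (rho M piE * A).
have b0 : 0 < b by rewrite !mulr_gt0 // A_gt0.
have L0 : 0 < L by apply: L_gt0; lia.
have so : Sopt M i s by exact: greedy_prefix_Sopt solvable _ gp (ltnW iT).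
(* The entry of the maximum [M1] at the maximizing action [g], whose Q-value is [q]. *)
pose x := q * Vstar M i s / D ^+ 2.
have x0 : 0 < x by rewrite divr_gt0 ?mulr_gt0 // exprn_gt0.
have xM : x <= M1 M piE by rewrite /x -Qg M1_ge.
have mge := m_param_ge s a0 iT x0 xM.
have m0 : (0 < m)%N.
  by rewrite -(ltr0n R); apply: lt_le_trans mge; rewrite !mulr_gt0 ?invr_gt0 ?exprn_gt0 ?A_gt0.
have mL : L * (12 * q * b) <= m%:R * D ^+ 2.
  rewrite -ler_pdivrMr ?exprn_gt0 //; apply: le_trans mge.
  by rewrite le_eqVlt /b /x; apply/orP; left; apply/eqP; field; rewrite gt_eqF.
have p0 (w : traj M) : 0 <= trajProb (curPol M piE pre) w by exact: trajProb_ge0.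
pose mean (W : {ffun 'I_m -> traj M}) a := est piE pre W a.
(* One bad event per action: too low an estimate for [g], too high a one for a non-maximizer. The
   union bound thus costs only a factor A. *)
pose ev a (W : {ffun 'I_m -> traj M}) : bool :=
  if a == g then mean W g <= q - D / 2
  else ~~ greedy i s a && (q - D / 2 <= mean W a).
have mgf a l := @score_mgf pre a l iT b0.
have tail a : \sum_(W : {ffun 'I_m -> traj M})
    \prod_j trajProb (curPol M piE pre) (W j) * (ev a W)%:R <= expR (- L).
  rewrite /ev; case: eqVneq => [_|_].
    under eq_bigr do rewrite /mean est_score //.
    exact: (lower_tail p0 m0 b0 D0 Dq (mgf g) mL Qg).
  case: (boolP (greedy i s a)) => [_|ng] /=.
    by rewrite big1 ?expR_ge0 // => W _; rewrite mulr0.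
  under eq_bigr do rewrite /mean est_score //.
  exact: (upper_tail p0 m0 b0 D0 Dq (mgf a) mL (Qng _ ng)).
apply: (@le_trans _ _ (\sum_a \sum_(W : {ffun 'I_m -> traj M})
    \prod_j trajProb (curPol M piE pre) (W j) * (ev a W)%:R)); last first.
  (* [expR (- L)] is [1 / (2 T A)], summed over A actions. *)
  apply: le_trans (ler_sum _ (fun a _ => tail a)) _.
  have x1 : 0 < 2 * T%:R * A by rewrite !mulr_gt0 // A_gt0.
  rewrite sumr_const expRN lnK ?posrE // -[leLHS]mulr_natl ler_pdivrMr //.
  by rewrite mulrA mulVf ?mul1r // gt_eqF // mulr_gt0.
rewrite exchange_big /=; apply: ler_sum => W _; rewrite -mulr_sumr.
rewrite ler_wpM2l ?prodr_ge0 //; set c := choose _ _ _.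
have ge0 a : 0 <= (ev a W)%:R :> R by exact: ler0n.
case: (boolP (greedy i s c)) => [_|ngc]; first exact: sumr_ge0.
have cg : c != g by apply: contraNneq ngc => ->.
(* If the estimate of [g] is above [q - D / 2], so is that of the chosen action [c], which maximizes
   the estimates. *)
have [lo|hi] := leP (mean W g) (q - D / 2).
  by rewrite (bigD1 g) //= {1}/ev eqxx lo lerDl sumr_ge0.
rewrite (bigD1 c) //= {1}/ev (negbTE cg) ngc /=.
by rewrite (le_trans (ltW hi)) ?choose_max // lerDl sumr_ge0.
Qed.

Lemma succ_ge0 n pre : 0 <= succ M piE choose m n pre.
Proof.
elim: n pre => [|n IHn] pre /=; first exact: ler0n.
apply: sumr_ge0 => W _; rewrite mulr_ge0 //; apply: prodr_ge0 => j _.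
exact/trajProb_ge0/valid_curPol.
Qed.

(** Union bound over the [n] remaining stages, by induction on [n]. *)
Lemma succ_ge n pre : (size pre + n)%N = T -> greedy_prefix M piE a0 pre ->
  1 - n%:R * (2 * T%:R)^-1 <= succ M piE choose m n pre.
Proof.
elim: n pre => [|n IHn] pre szT gp /=.
  rewrite mul0r subr0 asboolT //.
  by apply: (greedy_prefix_optimal piE_valid solvable gp); rewrite -szT addn0.
have iT : (size pre < T)%N by lia.
have pol := valid_curPol piE_valid pre.
pose bad (W : {ffun 'I_m -> traj M}) := (~~ greedy (size pre) (st pre)
   (choose (size pre) (st pre) (est piE pre W))).
have T0 : 0 < T%:R :> R by rewrite ltr0n; lia.
have nT : 0 <= n%:R * (2 * T%:R)^-1 :> R by rewrite mulr_ge0 // invr_ge0 mulr_ge0.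
(* After a greedy choice the induction hypothesis applies; after a bad one success is merely
   nonnegative, and subtracting the indicator of [bad] makes the bound trivial. *)
apply: (@le_trans _ _ (\sum_(W : {ffun 'I_m -> traj M})
   \prod_j trajProb (curPol M piE pre) (W j)
     * ((1 - n%:R * (2 * T%:R)^-1) - (bad W)%:R))); last first.
  apply: ler_sum => W _; rewrite ler_wpM2l //.
    by apply: prodr_ge0 => j _; exact: trajProb_ge0.
  rewrite /bad; case: (boolP (greedy _ _ _)) => [gc|_] /=.
    rewrite subr0 IHn //; first by rewrite size_rcons addSnnS.
    exact: greedy_prefix_rcons.
  by apply: le_trans (succ_ge0 _ _); rewrite addrAC subrr add0r oppr_le0.
under eq_bigr do rewrite mulrBr.
rewrite sumrB -mulr_suml sum_trajProb // mul1r.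
rewrite -natr1 mulrDl mul1r opprD addrA lerD2l lerN2.
exact: stage_failure.
Qed.

Lemma success_prob_ge : 1 / 2 <= success_prob M piE choose m.
Proof.
have gp : greedy_prefix M piE a0 [::] by [].
have := @succ_ge T [::] erefl gp; apply: le_trans.
(* For [T = 0] the product [T * (2 T)^-1] is 0 instead of [1 / 2]. *)
have [->|Tn0] := eqVneq T 0%N; first by rewrite mul0r; lra.
rewrite invfM mulrCA divff ?pnatr_eq0 // mulr1; lra.
Qed.

End Algorithm.

Theorem mainTheorem6 (R : realType) (S Act : finType) (M : mdp R S Act)
    (piE : policy R S Act) (choose : nat -> S -> (Act -> R) -> Act) :
  (2 <= #|Act|)%N ->
  valid_policy M piE ->
  (forall t, (t < horizon M)%N -> forall s a, 0 < piE t s a) ->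
  QVI1_solvable M piE ->
  (forall s a, 0 <= rew M s a) ->
  (forall i s (g : Act -> R) a, g a <= g (choose i s g)) ->
  1 / 2 <= success_prob M piE choose (m_param M piE).
Proof.
move=> A2 vpi pi0 sol r0 chm.
have /card_gt0P[a0 _] : (0 < #|Act|)%N by exact: ltnW.
exact: success_prob_ge.
Qed.
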